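(* Let $(\mathcal{M},\mathcal{N})$ be a preadhesive structure on a category $\mathbf{X}$ with pullbacks. If $\mathcal{M}\cap\mathcal{N}$ contains every split monomorphism and every $\mathcal{M},\mathcal{N}$-codiagonal is in $\mathcal{N}$, then the following are equivalent: (1) every arrow in $\mathcal{M}$ is $\mathcal{N}$-adhesive and $\mathcal{M}$ is closed under $\mathcal{M},\mathcal{N}$-unions; (2) $\mathbf{X}$ is $\mathcal{M},\mathcal{N}$-adhesive.
   Context: Classes of arrows. A class $\mathcal{A}$ of arrows is stable under pullbacks (resp. pushouts) if for every pullback (resp. pushout) square with $f:A\to B$, $m:A\to C$, $n:B\to D$, $g:C\to D$, $n\circ f=g\circ m$, $n\in\mathcal{A}$ implies $m\in\mathcal{A}$ (resp. $m\in\mathcal{A}$ implies $n\in\mathcal{A}$); existence of the (co)limits is not assumed. $\mathcal{A}$ is closed under $\mathcal{B}$-decomposition if $g\circ f\in\mathcal{A}$ and $g\in\mathcal{B}$ imply $f\in\mathcal{A}$; closed under decomposition means closed under $\mathcal{A}$-decomposition. Preadhesive structure. A pair $(\mathcal{M},\mathcal{N})$ with $\mathcal{M}$ a class of monomorphisms and $\mathcal{N}$ a class of arrows of $\mathbf{X}$ such that: (1) $\mathcal{M}$ and $\mathcal{N}$ contain all isomorphisms and are closed under composition and decomposition; (2) $\mathcal{N}$ is closed under $\mathcal{M}$-decomposition; (3) $\mathcal{M}$ and $\mathcal{N}$ are stable under pullbacks and pushouts. Stable and Van Kampen squares. A pushout square $g:A\to B$, $m:A\to C$, $n:B\to D$,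 $f:C\to D$ is Van Kampen if for every commutative cube having it as bottom face, with top face $g':A'\to B'$, $m':A'\to C'$, $n':B'\to D'$, $f':C'\to D'$ and vertical arrows $a:A'\to A$, $b:B'\to B$, $c:C'\to C$, $d:D'\to D$, such that the two vertical faces containing $a$ are pullbacks, the top face is a pushout if and only if the two vertical faces containing $d$ are pullbacks. It is stable if the ''if'' half holds (the two faces containing $d$ being pullbacks implies the top face is a pushout). $\mathcal{M},\mathcal{N}$-adhesivity. $\mathbf{X}$ is $\mathcal{M},\mathcal{N}$-adhesive if $(\mathcal{M},\mathcal{N})$ is a preadhesive structure and: (1) pullbacks of arrows in $\mathcal{M}$ along arbitrary arrows exist; (2) for $m:X\to Y$ in $\mathcal{M}$ and $n:X\to Z$ in $\mathcal{N}$ a pushout of $m$ and $n$ exists (an $\mathcal{M},\mathcal{N}$-pushout); (3) $\mathcal{M},\mathcal{N}$-pushouts are Van Kampen squares. $\mathcal{N}$-adhesive arrows. An arrow $m:X\to Y$ is $\mathcal{N}$-preadhesive if for every $n:X\to Z$ in $\mathcal{N}$ a stable pushout square of $m$ along $n$ exists and it is also a pullback square. It is $\mathcal{N}$-adhesive if all its pullbacks are $\mathcal{N}$-preadhesive. Codiagonals. If $f:X\to Y$ admits a pushout along itself, with coprojections $y_1,y_2:Y\rightrightarrows Q_f$, its codiagonal $\upsilon_f:Q_f\to Y$ is the unique arrow with $\upsilon_f\circ y_1=\mathrm{id}_Y=\upsilon_f\circ y_2$. An $\mathcal{M},\mathcal{N}$-codiagonal is the codiagonal of an arrow $n\in\mathcal{M}\cap\mathcal{N}$.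 Unions. $(\mathsf{Sub}(X),\le)$ is the poset of subobjects of $X$ (isomorphism classes $[m]$ of monos into $X$, ordered by factorization). A mono $u:U\to X$ is an $\mathcal{M},\mathcal{N}$-union if there are $m\in\mathcal{M}$ and $n\in\mathcal{M}\cap\mathcal{N}$ with codomain $X$ such that $[u]=[m]\vee[n]$ in $(\mathsf{Sub}(X),\le)$. $\mathcal{M}$ is closed under $\mathcal{M},\mathcal{N}$-unions if it contains all such monos. A split monomorphism is an arrow having a left inverse. *)

(* Defs.v *)
Set Implicit Arguments.
Unset Strict Implicit.
Unset Printing Implicit Defensive.

Declare Scope cat_scope.
Delimit Scope cat_scope with cat.

Record category := Category {
  Obj :> Type;
  Hom : Obj -> Obj -> Type;
  idm : forall A, Hom A A;
  comp : forall A B C, Hom B C -> Hom A B -> Hom A C;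
  comp_idl : forall A B (f : Hom A B), comp (idm B) f = f;
  comp_idr : forall A B (f : Hom A B), comp f (idm A) = f;
  comp_assoc : forall A B C D (h : Hom C D) (g : Hom B C) (f : Hom A B),
    comp h (comp g f) = comp (comp h g) f
}.

Arguments Hom {c} A B.
Arguments idm {c} A.
Arguments comp {c A B C} g f.

Notation "A ~> B" := (Hom A B) (at level 70, no associativity) : cat_scope.
Notation "g ∘ f" := (comp g f) (at level 40, left associativity) : cat_scope.

Local Open Scope cat_scope.

Definition arrow_class (X : category) := forall A B : X, (A ~> B) -> Prop.

Section Arrows.
Variable X : category.

Definition is_mono (A B : X) (f : A ~> B) : Prop :=
  forall (T : X) (x y : T ~> A), f ∘ x = f ∘ y -> x = y.

Definition is_iso (A B : X) (f : A ~> B) : Prop :=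
  exists g : B ~> A, g ∘ f = idm A /\ f ∘ g = idm B.

Definition is_split_mono (A B : X) (f : A ~> B) : Prop :=
  exists r : B ~> A, r ∘ f = idm A.

(* All squares are given as
<<
        f
     A ---> B
   m |      | n
     v      v
     C ---> D
        g
>>
   with arguments in the order f, m, n, g. *)
Definition commutes (A B C D : X)
    (f : A ~> B) (m : A ~> C) (n : B ~> D) (g : C ~> D) : Prop :=
  n ∘ f = g ∘ m.

Definition is_pullback (A B C D : X)
    (f : A ~> B) (m : A ~> C) (n : B ~> D) (g : C ~> D) : Prop :=
  commutes f m n g /\
  forall (T : X) (x : T ~> B) (y : T ~> C), n ∘ x = g ∘ y ->
    exists! k : T ~> A, f ∘ k = x /\ m ∘ k = y.

Definition is_pushout (A B C D : X)
    (f : A ~> B) (m : A ~> C) (n : B ~> D) (g : C ~> D) : Prop :=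
  commutes f m n g /\
  forall (T : X) (x : B ~> T) (y : C ~> T), x ∘ f = y ∘ m ->
    exists! k : D ~> T, k ∘ n = x /\ k ∘ g = y.

Definition has_pullbacks : Prop :=
  forall (B C D : X) (n : B ~> D) (g : C ~> D),
    exists (A : X) (f : A ~> B) (m : A ~> C), is_pullback f m n g.

Definition contains_isos (P : arrow_class X) : Prop :=
  forall (A B : X) (f : A ~> B), is_iso f -> P A B f.

Definition closed_under_comp (P : arrow_class X) : Prop :=
  forall (A B C : X) (f : A ~> B) (g : B ~> C),
    P A B f -> P B C g -> P A C (g ∘ f).

Definition closed_under_decomp (Q P : arrow_class X) : Prop :=
  forall (A B C : X) (f : A ~> B) (g : B ~> C),
    P A C (g ∘ f) -> Q B C g -> P A B f.

Definition stable_under_pullbacks (P : arrow_class X) : Prop :=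
  forall (A B C D : X) (f : A ~> B) (m : A ~> C) (n : B ~> D) (g : C ~> D),
    is_pullback f m n g -> P B D n -> P A C m.

Definition stable_under_pushouts (P : arrow_class X) : Prop :=
  forall (A B C D : X) (f : A ~> B) (m : A ~> C) (n : B ~> D) (g : C ~> D),
    is_pushout f m n g -> P A C m -> P B D n.

Record preadhesive (M N : arrow_class X) : Prop := Preadhesive {
  preadh_mono : forall (A B : X) (m : A ~> B), M A B m -> is_mono m;
  preadh_isoM : contains_isos M;
  preadh_isoN : contains_isos N;
  preadh_compM : closed_under_comp M;
  preadh_compN : closed_under_comp N;
  preadh_decompM : closed_under_decomp M M;
  preadh_decompN : closed_under_decomp N N;
  preadh_decompMN : closed_under_decomp M N;
  preadh_pullM : stable_under_pullbacks M;
  preadh_pullN : stable_under_pullbacks N;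
  preadh_pushM : stable_under_pushouts M;
  preadh_pushN : stable_under_pushouts N
}.

(* A commutative cube over the bottom square (g, m, n, f), with top square
   (g', m', n', f') and vertical arrows a, b, c, d. *)
Definition is_cube (A B C D A' B' C' D' : X)
    (g : A ~> B) (m : A ~> C) (n : B ~> D) (f : C ~> D)
    (g' : A' ~> B') (m' : A' ~> C') (n' : B' ~> D') (f' : C' ~> D')
    (a : A' ~> A) (b : B' ~> B) (c : C' ~> C) (d : D' ~> D) : Prop :=
  commutes g m n f /\ commutes g' m' n' f' /\
  commutes g' a b g /\ commutes m' a c m /\
  commutes n' b d n /\ commutes f' c d f.

Definition is_van_kampen (A B C D : X)
    (g : A ~> B) (m : A ~> C) (n : B ~> D) (f : C ~> D) : Prop :=
  is_pushout g m n f /\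
  forall (A' B' C' D' : X)
    (g' : A' ~> B') (m' : A' ~> C') (n' : B' ~> D') (f' : C' ~> D')
    (a : A' ~> A) (b : B' ~> B) (c : C' ~> C) (d : D' ~> D),
    is_cube g m n f g' m' n' f' a b c d ->
    is_pullback g' a b g -> is_pullback m' a c m ->
    (is_pushout g' m' n' f' <->
     is_pullback n' b d n /\ is_pullback f' c d f).

Definition is_stable_pushout (A B C D : X)
    (g : A ~> B) (m : A ~> C) (n : B ~> D) (f : C ~> D) : Prop :=
  is_pushout g m n f /\
  forall (A' B' C' D' : X)
    (g' : A' ~> B') (m' : A' ~> C') (n' : B' ~> D') (f' : C' ~> D')
    (a : A' ~> A) (b : B' ~> B) (c : C' ~> C) (d : D' ~> D),
    is_cube g m n f g' m' n' f' a b c d ->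
    is_pullback g' a b g -> is_pullback m' a c m ->
    is_pullback n' b d n /\ is_pullback f' c d f ->
    is_pushout g' m' n' f'.

Record adhesive (M N : arrow_class X) : Prop := Adhesive {
  adh_preadhesive : preadhesive M N;
  adh_pullback : forall (B C D : X) (m : B ~> D) (g : C ~> D), M B D m ->
    exists (A : X) (f : A ~> B) (m' : A ~> C), is_pullback f m' m g;
  adh_pushout : forall (A B C : X) (m : A ~> C) (n : A ~> B),
    M A C m -> N A B n ->
    exists (D : X) (p : B ~> D) (q : C ~> D), is_pushout n m p q;
  adh_van_kampen : forall (A B C D : X)
    (n : A ~> B) (m : A ~> C) (p : B ~> D) (q : C ~> D),
    M A C m -> N A B n -> is_pushout n m p q -> is_van_kampen n m p q
}.

Definition preadhesive_arrow (N : arrow_class X) (A C : X) (m : A ~> C)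
    : Prop :=
  forall (B : X) (n : A ~> B), N A B n ->
    exists (D : X) (p : B ~> D) (q : C ~> D),
      is_stable_pushout n m p q /\ is_pullback n m p q.

Definition adhesive_arrow (N : arrow_class X) (B D : X) (m : B ~> D) : Prop :=
  forall (A C : X) (f : A ~> B) (m' : A ~> C) (g : C ~> D),
    is_pullback f m' m g -> preadhesive_arrow N m'.

Definition is_codiagonal (A B Q : X) (f : A ~> B) (v : Q ~> B) : Prop :=
  exists y1 y2 : B ~> Q,
    is_pushout f f y1 y2 /\ v ∘ y1 = idm B /\ v ∘ y2 = idm B.

Definition is_MN_codiagonal (M N : arrow_class X) (Q B : X) (v : Q ~> B)
    : Prop :=
  exists (A : X) (n : A ~> B), M A B n /\ N A B n /\ is_codiagonal n v.

(* The preorder on monos into Z whose poset reflection is Sub(Z). *)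
Definition sub_le (A B Z : X) (a : A ~> Z) (b : B ~> Z) : Prop :=
  exists k : A ~> B, b ∘ k = a.

(* [u] = [m] \/ [n] in Sub(Z), expressed on the representatives u, m, n. *)
Definition is_sub_join (U A B Z : X) (u : U ~> Z) (m : A ~> Z) (n : B ~> Z)
    : Prop :=
  sub_le m u /\ sub_le n u /\
  forall (V : X) (v : V ~> Z), is_mono v ->
    sub_le m v -> sub_le n v -> sub_le u v.

Definition is_MN_union (M N : arrow_class X) (U Z : X) (u : U ~> Z) : Prop :=
  is_mono u /\
  exists (A B : X) (m : A ~> Z) (n : B ~> Z),
    M A Z m /\ M B Z n /\ N B Z n /\ is_sub_join u m n.

Definition closed_under_MN_unions (M N : arrow_class X) : Prop :=
  forall (U Z : X) (u : U ~> Z), is_MN_union M N u -> M U Z u.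

End Arrows.

(* Main.v *)
(** Both conditions make every M,N-pushout a stable pushout and a pullback, so
    its two legs form a pullback-stable jointly epic cover, and maps can be
    factored through monomorphisms piece by piece.  The bridge between the two
    conditions is a description of kernel pairs: in an M,N-pushout

        A --g--> B
      m |        | n
        C --f--> D

    the kernel pair of f is the pushout of C and of the kernel pair of g over
    A.  It follows from the Van Kampen property applied to the cube that compares
    second projections with g and f along first projections, and also from
    closure under unions, since that pushout is the union of the diagonal of f
    and the kernel pair of g.

    Given the description, the Van Kampen property is checked locally.
    Conversely, the union U of m : A -> Z and n : B -> Z is the equalizer of the
    coprojections of Z into its cokernel pair D = Z +_U Z, which are split
    monos; D is built by gluing Q = Z +_B Z along the codiagonal of the
    pullback of n along m. *)

From Stdlib Require Import ssreflect ssrfun.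
Require Import Defs.

Local Open Scope cat_scope.

(** * Pullback and pushout calculus, and stable pushouts *)

Section Squares.
Context {X : category}.

Lemma precomp {A B C E : X} {g : B ~> C} {f : A ~> B} {h : A ~> C}
    (e : g ∘ f = h) (x : E ~> A) : g ∘ (f ∘ x) = h ∘ x.
Proof. by rewrite comp_assoc e. Qed.

Lemma pullback_intro {A B C D : X}
    {f : A ~> B} {m : A ~> C} {n : B ~> D} {g : C ~> D} :
  n ∘ f = g ∘ m ->
  (forall (T : X) (x : T ~> B) (y : T ~> C), n ∘ x = g ∘ y ->
     exists k : T ~> A, f ∘ k = x /\ m ∘ k = y) ->
  (forall (T : X) (k k' : T ~> A), f ∘ k = f ∘ k' -> m ∘ k = m ∘ k' ->
     k = k') ->
  is_pullback f m n g.
Proof.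
move=> e lift uniq; split=> // T x y exy.
have [k [kx ky]] := lift T x y exy.
exists k; split=> // k' [kx' ky'].
by apply: uniq; [rewrite kx kx' | rewrite ky ky'].
Qed.

Lemma pullback_lift {A B C D : X}
    {f : A ~> B} {m : A ~> C} {n : B ~> D} {g : C ~> D} :
  is_pullback f m n g ->
  forall {T : X} {x : T ~> B} {y : T ~> C}, n ∘ x = g ∘ y ->
    exists k : T ~> A, f ∘ k = x /\ m ∘ k = y.
Proof. by move=> [_ pb] T x y e; have [k [kP _]] := pb T x y e; exists k. Qed.

Lemma pullback_uniq {A B C D : X}
    {f : A ~> B} {m : A ~> C} {n : B ~> D} {g : C ~> D} :
  is_pullback f m n g ->
  forall (T : X) (k k' : T ~> A), f ∘ k = f ∘ k' -> m ∘ k = m ∘ k' -> k = k'.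
Proof.
move=> [e pb] T k k' ef em.
have [|l [_ lP]] := pb T (f ∘ k) (m ∘ k); first by rewrite !comp_assoc e.
by rewrite -(lP k) // -(lP k').
Qed.

Lemma pushout_intro {A B C D : X}
    {f : A ~> B} {m : A ~> C} {n : B ~> D} {g : C ~> D} :
  n ∘ f = g ∘ m ->
  (forall (T : X) (x : B ~> T) (y : C ~> T), x ∘ f = y ∘ m ->
     exists k : D ~> T, k ∘ n = x /\ k ∘ g = y) ->
  (forall (T : X) (k k' : D ~> T), k ∘ n = k' ∘ n -> k ∘ g = k' ∘ g ->
     k = k') ->
  is_pushout f m n g.
Proof.
move=> e desc uniq; split=> // T x y exy.
have [k [kx ky]] := desc T x y exy.
exists k; split=> // k' [kx' ky'].
by apply: uniq; [rewrite kx kx' | rewrite ky ky'].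
Qed.

Lemma pushout_desc {A B C D : X}
    {f : A ~> B} {m : A ~> C} {n : B ~> D} {g : C ~> D} :
  is_pushout f m n g ->
  forall {T : X} {x : B ~> T} {y : C ~> T}, x ∘ f = y ∘ m ->
    exists k : D ~> T, k ∘ n = x /\ k ∘ g = y.
Proof. by move=> [_ po] T x y /po [k [kP _]]; exists k. Qed.

Lemma pushout_uniq {A B C D : X}
    {f : A ~> B} {m : A ~> C} {n : B ~> D} {g : C ~> D} :
  is_pushout f m n g ->
  forall (T : X) (k k' : D ~> T), k ∘ n = k' ∘ n -> k ∘ g = k' ∘ g -> k = k'.
Proof.
move=> [e po] T k k' en eg.
have [|l [_ lP]] := po T (k ∘ n) (k ∘ g); first by rewrite -!comp_assoc e.
by rewrite -(lP k) // -(lP k').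
Qed.

Lemma pullback_sym {A B C D : X}
    {f : A ~> B} {m : A ~> C} {n : B ~> D} {g : C ~> D} :
  is_pullback f m n g -> is_pullback m f g n.
Proof.
move=> pb; apply: pullback_intro; first by case: pb.
- move=> T x y /esym e; have [k [? ?]] := pullback_lift pb e.
  by exists k.
- by move=> T k k' em ef; apply: (pullback_uniq pb).
Qed.

Lemma pushout_sym {A B C D : X}
    {f : A ~> B} {m : A ~> C} {n : B ~> D} {g : C ~> D} :
  is_pushout f m n g -> is_pushout m f g n.
Proof.
move=> po; apply: pushout_intro; first by case: po.
- move=> T x y /esym e; have [k [? ?]] := pushout_desc po e.
  by exists k.
- by move=> T k k' em ef; apply: (pushout_uniq po).
Qed.

Lemma pullback_id {A B : X} (f : A ~> B) : is_pullback f (idm A) (idm B) f.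
Proof.
apply: pullback_intro.
- by rewrite comp_idl comp_idr.
- by move=> T x y; rewrite comp_idl => ->; exists y; rewrite comp_idl.
- by move=> T k k' _; rewrite !comp_idl.
Qed.

Lemma pushout_id {A B : X} (f : A ~> B) : is_pushout f (idm A) (idm B) f.
Proof.
apply: pushout_intro.
- by rewrite comp_idl comp_idr.
- by move=> T x y; rewrite comp_idr => <-; exists x; rewrite comp_idr.
- by move=> T k k'; rewrite !comp_idr.
Qed.

Lemma pullback_id_mono {A B : X} {f : A ~> B} :
  is_mono f -> is_pullback (idm A) (idm A) f f.
Proof.
move=> fm; apply: pullback_intro => //.
- by move=> T x y /fm ->; exists y; rewrite comp_idl.
- by move=> T k k'; rewrite !comp_idl.
Qed.

Lemma pushout_cancel {A B C D E F : X} {f : A ~> B} {m : A ~> C} {n : B ~> D}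
    {g : C ~> D} {f' : B ~> E} {p : E ~> F} {g' : D ~> F} :
  is_pushout f m n g -> is_pushout (f' ∘ f) m p (g' ∘ g) ->
  p ∘ f' = g' ∘ n -> is_pushout f' n p g'.
Proof.
move=> po1 po2 e; apply: pushout_intro => //.
- move=> T x y exy.
  have [|k [kp kg]] := pushout_desc po2 (x := x) (y := y ∘ g).
    case: po1 => e1 _; red in e1.
    by rewrite comp_assoc exy -!comp_assoc e1.
  exists k; split=> //; apply: (pushout_uniq po1).
    by rewrite -exy -kp -!comp_assoc e.
  by rewrite -kg -!comp_assoc.
- move=> T k k' ep eg; apply: (pushout_uniq po2) => //.
  by rewrite !comp_assoc eg.
Qed.

(** Three vertical faces suffice: the face over [m] pasted with the one over [f] equals the pasting
    of those over [g] and [n], so it is a pullback by cancellation. *)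
Lemma stable_pushout_pullback {A B C D A' B' C' D' : X}
    {g : A ~> B} {m : A ~> C} {n : B ~> D} {f : C ~> D}
    {g' : A' ~> B'} {m' : A' ~> C'} {n' : B' ~> D'} {f' : C' ~> D'}
    {a : A' ~> A} {b : B' ~> B} {c : C' ~> C} {d : D' ~> D} :
  is_stable_pushout g m n f ->
  is_pullback n' b d n -> is_pullback f' c d f -> is_pullback g' a b g ->
  n' ∘ g' = f' ∘ m' -> c ∘ m' = m ∘ a -> is_pushout g' m' n' f'.
Proof.
move=> [[epo _] st] pbn pbf pbg etop em.
case: (pbn) => en _; case: (pbf) => ef _; case: (pbg) => eg _.
apply: (st _ _ _ _ _ _ _ _ a b c d) => //.
red in epo, en, ef, eg.
apply: pullback_intro => //.
- move=> T x y exy.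
  have [|xB [xB1 xB2]] := pullback_lift pbn (x := f' ∘ x) (y := g ∘ y).
    by rewrite (precomp ef) -comp_assoc exy !comp_assoc epo.
  have [k [k1 k2]] := pullback_lift pbg xB2.
  exists k; split=> //; apply: (pullback_uniq pbf).
    by rewrite (precomp (esym etop)) -comp_assoc k1.
  by rewrite (precomp em) -comp_assoc k2.
- move=> T k k' e1 e2; apply: (pullback_uniq pbg) => //.
  apply: (pullback_uniq pbn).
    by rewrite !(precomp etop) -!comp_assoc e1.
  by rewrite !(precomp eg) -!comp_assoc e2.
Qed.

(** [preadhesive_arrow] yields one stable pushout, while the Van Kampen condition concerns all of
    them. Stability passes along the comparison [h], which has the left inverse [h']. *)
Lemma stable_pushout_transport {A B C D E : X}
    {g : A ~> B} {m : A ~> C} {n : B ~> D} {f : C ~> D}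
    {n' : B ~> E} {f' : C ~> E} :
  is_stable_pushout g m n f -> is_pullback g m n f ->
  is_pushout g m n' f' ->
  is_stable_pushout g m n' f' /\ is_pullback g m n' f'.
Proof.
move=> [po st] pb po'.
case: (po) => e _; case: (po') => e' _; red in e, e'.
have [h [hn hf]] := pushout_desc po' e.
have [h' [hn' hf']] := pushout_desc po e'.
have h'h : h' ∘ h = idm E.
  by apply: (pushout_uniq po'); rewrite -comp_assoc comp_idl ?hn ?hf.
have front P Q (r : P ~> Q) R (s : P ~> R) (t : Q ~> E) (v : R ~> D)
    (v' : R ~> E) : h ∘ v' = v -> is_pullback r s t v' ->
    is_pullback r s (h ∘ t) v.
  { move=> ev pbr; case: (pbr) => er _; red in er; apply: pullback_intro.
  - by rewrite -comp_assoc er comp_assoc ev.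
  - move=> T x y exy; apply: (pullback_lift pbr).
    rewrite -(comp_idl (t ∘ x)) -h'h -comp_assoc (comp_assoc h) exy.
    by rewrite -ev -comp_assoc comp_assoc h'h comp_idl.
  - exact: (pullback_uniq pbr). }
split.
- split=> // A1 B1 C1 D1 g1 m1 n1 f1 a b c d.
  move=> [_ [c2 [c3 [c4 [c5 c6]]]]] pb1 pb2 [pb3 pb4].
  have pb3' := front _ _ _ _ _ _ _ _ hn pb3.
  have pb4' := front _ _ _ _ _ _ _ _ hf pb4.
  apply: (st _ _ _ _ _ _ _ _ a b c (h ∘ d)) => //.
  by case: pb3'; case: pb4'.
- apply: pullback_intro => //; last exact: (pullback_uniq pb).
  move=> T x y exy; apply: (pullback_lift pb).
  by rewrite -hn -hf -!comp_assoc exy.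
Qed.

Lemma split_mono_is_mono {A B : X} {f : A ~> B} : is_split_mono f -> is_mono f.
Proof.
move=> [r rf] T x y e.
by rewrite -(comp_idl x) -(comp_idl y) -rf -!comp_assoc e.
Qed.

(* A Van Kampen square is pulled back along [n] to the trivial pushout on
   [g]. *)
Lemma van_kampen_pullback {A B C D : X}
    {g : A ~> B} {m : A ~> C} {n : B ~> D} {f : C ~> D} :
  is_mono m -> is_van_kampen g m n f -> is_pullback g m n f.
Proof.
move=> mm [[e _] vk].
have pbm := pullback_id_mono mm.
have [|_ //] := proj1 (vk A B A B g (idm A) (idm B) g (idm A) (idm B) m n _
  (pullback_id g) pbm) (pushout_id g).
repeat split=> //; rewrite /commutes ?comp_idl ?comp_idr //.
Qed.

Lemma van_kampen_stable {A B C D : X}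
    {g : A ~> B} {m : A ~> C} {n : B ~> D} {f : C ~> D} :
  is_van_kampen g m n f -> is_stable_pushout g m n f.
Proof.
move=> [po vk]; split=> // A' B' C' D' g' m' n' f' a b c d cube pb1 pb2.
by case: (vk _ _ _ _ _ _ _ _ a b c d cube pb1 pb2).
Qed.

(** * Covers and factorization through monomorphisms *)

Definition factors {U T Z : X} (u : U ~> Z) (t : T ~> Z) : Prop :=
  exists k : T ~> U, u ∘ k = t.

(** With [t] an identity, the second clause says that no proper subobject of [W] contains the
    family. *)
Definition covers (W : X) (P : forall S : X, (S ~> W) -> Prop) : Prop :=
  (forall (V : X) (x y : W ~> V),
     (forall S (s : S ~> W), P S s -> x ∘ s = y ∘ s) -> x = y) /\
  (forall (U Z : X) (u : U ~> Z) (t : W ~> Z), is_mono u ->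
     (forall S (s : S ~> W), P S s -> factors u (t ∘ s)) -> factors u t).

Lemma covers_sub {W : X} {P Q : forall S : X, (S ~> W) -> Prop} :
  (forall S s, P S s -> Q S s) -> covers W P -> covers W Q.
Proof.
move=> PQ [cov1 cov2]; split.
- by move=> V x y h; apply: cov1 => S s /PQ; apply: h.
- by move=> U Z u t um h; apply: (cov2 _ _ u t um) => S s /PQ; apply: h.
Qed.

(** Pulled back along [w], the square stays a pushout, and its coprojections [n'] and [f'] belong to
    the family. Factorizations on these two pieces agree on [A'] because [u] is mono, so they
    glue. *)
Lemma stable_pushout_covers (hpb : has_pullbacks X) {A B C D W : X}
    {g : A ~> B} {m : A ~> C} {n : B ~> D} {f : C ~> D} (w : W ~> D) :
  is_stable_pushout g m n f ->
  covers W (fun S s => factors n (w ∘ s) \/ factors f (w ∘ s)).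
Proof.
move=> st.
have [B' [n' [b pbn]]] := hpb _ _ _ w n.
have [C' [f' [c pbf]]] := hpb _ _ _ w f.
have [A' [g' [a pbg]]] := hpb _ _ _ b g.
case: (st) => [[e _] _]; case: (pbn) => en _; case: (pbg) => eg _.
case: (pbf) => ef _; red in e, en, eg, ef.
have [|m' [fm cm]] := pullback_lift pbf (x := n' ∘ g') (y := m ∘ a).
  by rewrite comp_assoc en -comp_assoc eg !comp_assoc e.
have po : is_pushout g' m' n' f'.
  exact: (stable_pushout_pullback st pbn pbf pbg (esym fm) cm).
have joint V (x y : W ~> V) : (forall S (s : S ~> W),
    factors n (w ∘ s) \/ factors f (w ∘ s) -> x ∘ s = y ∘ s) -> x = y.
  move=> h; apply: (pushout_uniq po); apply: h.
    by left; exists b.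
  by right; exists c.
split=> // U Z u t um h.
have [|x xP] := h _ n'; first by left; exists b.
have [|y yP] := h _ f'; first by right; exists c.
have [|k [k1 k2]] := pushout_desc po (x := x) (y := y).
  by apply: um; rewrite (precomp xP) (precomp yP) -!comp_assoc fm.
exists k; apply: (pushout_uniq po); rewrite -comp_assoc.
  by rewrite k1.
by rewrite k2.
Qed.

(* Monicity is tested on the four pieces of the domain obtained by pulling the
   pushout back along both members of a parallel pair. *)
Lemma union_pushout (hpb : has_pullbacks X) {P A B U Z : X}
    {p : P ~> A} {q : P ~> B} {m : A ~> Z} {n : B ~> Z}
    {i : A ~> U} {j : B ~> U} {u : U ~> Z} :
  is_mono m -> is_mono n -> is_pullback p q m n -> is_stable_pushout p q i j ->
  u ∘ i = m -> u ∘ j = n -> is_mono u /\ is_sub_join u m n.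
Proof.
move=> mm nm pb st ui uj; case: (st) => [po _]; case: (po) => e _; red in e.
split; last first.
  split; first by exists i.
  split; first by exists j.
  move=> V v vm [x xP] [y yP].
  have [|k [k1 k2]] := pushout_desc po (x := x) (y := y).
    apply: vm; rewrite (precomp xP) (precomp yP).
    by case: pb.
  exists k; apply: (pushout_uniq po); rewrite -comp_assoc.
    by rewrite k1 xP ui.
  by rewrite k2 yP uj.
have cross S (x : S ~> A) (y : S ~> B) : u ∘ (i ∘ x) = u ∘ (j ∘ y) ->
    i ∘ x = j ∘ y.
  rewrite (precomp ui) (precomp uj) => exy.
  have [k [<- <-]] := pullback_lift pb exy.
  by rewrite (precomp e) -comp_assoc.
move=> T x y exy.
apply: (proj1 (stable_pushout_covers hpb x st)) => S s xs.
apply: (proj1 (stable_pushout_covers hpb (y ∘ s) st)) => S' s' ys.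
have exy' : u ∘ (x ∘ s ∘ s') = u ∘ (y ∘ s ∘ s') by rewrite !comp_assoc exy.
move: exy'; case: xs => [[k <-]|[k <-]]; case: ys => [[l <-]|[l <-]];
  rewrite -!(comp_assoc _ k).
- by rewrite !(precomp ui) => /mm ->.
- by move=> /cross.
- by move=> /esym /cross.
- by rewrite !(precomp uj) => /nm ->.
Qed.

End Squares.

(** * The kernel pair of a leg of an [M],[N]-pushout *)

Section Kernels.
Context {X : category} {M N : arrow_class X}.
Hypothesis hMN : preadhesive M N.
Hypothesis hpb : has_pullbacks X.
Hypothesis hsplit : forall (A B : X) (f : A ~> B),
  is_split_mono f -> M A B f /\ N A B f.
Hypothesis pushout_exists : forall {A B C : X} {m : A ~> C} {n : A ~> B},
  M A C m -> N A B n ->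
  exists (D : X) (p : B ~> D) (q : C ~> D), is_pushout n m p q.
Hypothesis pushout_stable : forall {A B C D : X}
  {n : A ~> B} {m : A ~> C} {p : B ~> D} {q : C ~> D},
  M A C m -> N A B n -> is_pushout n m p q ->
  is_stable_pushout n m p q /\ is_pullback n m p q.

(** The kernel pair of [f] is covered by the diagonal of [C] and the kernel pair of [g], in terms of
    generalized elements. Later arguments use the description of the kernel pair only in this
    form. *)
Definition kernel_splits {A B C D : X} (g : A ~> B) (m : A ~> C) (f : C ~> D)
    : Prop :=
  forall (T : X) (x y : T ~> C), f ∘ x = f ∘ y ->
    covers T (fun S s => x ∘ s = y ∘ s \/
      exists v w : S ~> A, m ∘ v = x ∘ s /\ m ∘ w = y ∘ s /\ g ∘ v = g ∘ w).

(* [K] with [j1], [j2] is the kernel pair of [g] and [E] is the pushout of its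
   diagonal along [m]; [q1], [q2] are the candidate projections making [E] the
   kernel pair of [f]. *)
Record kernel_gluing {A B C D : X} (g : A ~> B) (m : A ~> C) (f : C ~> D)
    {K E : X} (j1 j2 : K ~> A) (e1 : K ~> E) (e2 : C ~> E) (q1 q2 : E ~> C)
    : Prop := KernelGluing {
  glue_ker : is_pullback j1 j2 g g;
  glue_stable : exists d : A ~> K, j1 ∘ d = idm A /\ j2 ∘ d = idm A /\
    is_stable_pushout d m e1 e2;
  glue_M : M _ _ e1;
  glue_q1e1 : q1 ∘ e1 = m ∘ j1;
  glue_q2e1 : q2 ∘ e1 = m ∘ j2;
  glue_q1e2 : q1 ∘ e2 = idm C;
  glue_q2e2 : q2 ∘ e2 = idm C;
  glue_comm : f ∘ q1 = f ∘ q2;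
  glue_pushout : is_pushout j2 e1 m q2
}.
Arguments glue_ker {A B C D g m f K E j1 j2 e1 e2 q1 q2}.
Arguments glue_stable {A B C D g m f K E j1 j2 e1 e2 q1 q2}.
Arguments glue_M {A B C D g m f K E j1 j2 e1 e2 q1 q2}.
Arguments glue_q1e1 {A B C D g m f K E j1 j2 e1 e2 q1 q2}.
Arguments glue_q2e1 {A B C D g m f K E j1 j2 e1 e2 q1 q2}.
Arguments glue_q1e2 {A B C D g m f K E j1 j2 e1 e2 q1 q2}.
Arguments glue_q2e2 {A B C D g m f K E j1 j2 e1 e2 q1 q2}.
Arguments glue_comm {A B C D g m f K E j1 j2 e1 e2 q1 q2}.
Arguments glue_pushout {A B C D g m f K E j1 j2 e1 e2 q1 q2}.

(** The diagonal [d] is split by [j1], hence in [N], so [E] exists. As [j2 ∘ d] and [q2 ∘ e2] are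
    identities, [glue_pushout] follows by cancelling the square of [E] from a trivial pushout. *)
Lemma kernel_gluing_exists {A B C D : X}
    {g : A ~> B} {m : A ~> C} {n : B ~> D} {f : C ~> D} :
  M A C m -> N A B g -> is_pushout g m n f ->
  exists (K E : X) (j1 j2 : K ~> A) (e1 : K ~> E) (e2 : C ~> E)
    (q1 q2 : E ~> C), kernel_gluing g m f j1 j2 e1 e2 q1 q2.
Proof.
move=> Mm Ng po; case: (po) => e _; red in e.
have [K [j1 [j2 pbK]]] := hpb _ _ _ g g.
case: (pbK) => ej _; red in ej.
have [d [d1 d2]] := pullback_lift pbK (erefl (g ∘ idm A)).
have [Md Nd] : M _ _ d /\ N _ _ d by apply: hsplit; exists j1.
have [E [e1 [e2 poE]]] := pushout_exists Mm Nd.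
have [stE _] := pushout_stable Mm Nd poE.
have [|q1 [q11 q12]] := pushout_desc poE (x := m ∘ j1) (y := idm C).
  by rewrite -comp_assoc d1 comp_idl comp_idr.
have [|q2 [q21 q22]] := pushout_desc poE (x := m ∘ j2) (y := idm C).
  by rewrite -comp_assoc d2 comp_idl comp_idr.
exists K, E, j1, j2, e1, e2, q1, q2; split=> //.
- by exists d.
- exact: (preadh_pushM hMN poE Mm).
- apply: (pushout_uniq poE).
    by rewrite -!comp_assoc q11 q21 !comp_assoc -e -!comp_assoc ej.
  by rewrite -!comp_assoc q12 q22.
- apply: (pushout_cancel poE) => //.
  by rewrite d2 q22; apply: pushout_sym; apply: pushout_id.
Qed.

(** A pair identified by [f] is a map [w] into [E]; pulling the cover of [E] by [K] and [C] back
    along [w] gives the two alternatives. *)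
Lemma kernel_gluing_splits {A B C D K E : X}
    {g : A ~> B} {m : A ~> C} {f : C ~> D}
    {j1 j2 : K ~> A} {e1 : K ~> E} {e2 : C ~> E} {q1 q2 : E ~> C} :
  kernel_gluing g m f j1 j2 e1 e2 q1 q2 -> is_pullback q2 q1 f f ->
  kernel_splits g m f.
Proof.
move=> G pb T x y /esym exy.
have [w [w2 w1]] := pullback_lift pb exy.
have [d [_ [_ st]]] := glue_stable G.
apply: covers_sub (stable_pushout_covers hpb w st) => S s [[k kP]|[k kP]].
- right; exists (j1 ∘ k), (j2 ∘ k); split; [|split].
  + by rewrite comp_assoc -(glue_q1e1 G) -comp_assoc kP comp_assoc w1.
  + by rewrite comp_assoc -(glue_q2e1 G) -comp_assoc kP comp_assoc w2.
  + by case: (glue_ker G) => ej _; rewrite !comp_assoc ej.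
- left; rewrite -w1 -w2 -!comp_assoc -kP !comp_assoc.
  by rewrite (glue_q1e2 G) (glue_q2e2 G).
Qed.

Lemma kernel_splits_van_kampen {A B C D : X}
    {g : A ~> B} {m : A ~> C} {n : B ~> D} {f : C ~> D} :
  M A C m -> N A B g -> is_van_kampen g m n f -> kernel_splits g m f.
Proof.
move=> Mm Ng [po vk].
have [K [E [j1 [j2 [e1 [e2 [q1 [q2 G]]]]]]]] := kernel_gluing_exists Mm Ng po.
apply: (kernel_gluing_splits G).
have [d [d1 [d2 st]]] := glue_stable G.
have pbK := pullback_sym (glue_ker G).
have mm := preadh_mono hMN Mm.
have e1m := preadh_mono hMN (glue_M G).
(* Where [x] comes from [c] in [C], applying [q1] gives [c = m ∘ y], so [x] lies on the diagonal [d]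
   and hence in [K]. *)
have pbE : is_pullback e1 j1 q1 m.
{ apply: pullback_intro; first exact: (glue_q1e1 G).
  - move=> T x y exy.
    have [k kP] : factors e1 x.
      apply: (proj2 (stable_pushout_covers hpb x st)) => // S s [//|[c cP]].
      exists (d ∘ (y ∘ s)).
      case: st => [[ed _] _]; red in ed.
      rewrite (precomp ed) -cP -comp_assoc; congr (_ ∘ _).
      rewrite comp_assoc -exy -comp_assoc -cP comp_assoc (glue_q1e2 G).
      exact: comp_idl.
    exists k; split=> //; apply: mm.
    by rewrite comp_assoc -(glue_q1e1 G) -comp_assoc kP.
  - by move=> T k k' /e1m. }
have cube : is_cube g m n f j2 e1 m q2 j1 g q1 f.
{ case: (po) => e _; case: pbK => ej _; case: (glue_pushout G) => eE _.
  do 3 (split; first done).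
  split; first exact: (glue_q1e1 G).
  split; first exact: (esym e).
  exact: (esym (glue_comm G)). }
by case: (proj1 (vk _ _ _ _ _ _ _ _ _ _ _ _ cube pbK pbE) (glue_pushout G)).
Qed.

(** The comparison [phi] from [E] to the kernel pair [L] of [f] is the union of [r] with the
    diagonal [D'], so it is in [M]. Its pushout along [q2], which is in [N], is then a pullback;
    there [phi] lies opposite an identity, hence is invertible. *)
Lemma kernel_splits_unions {A B C D : X}
    {g : A ~> B} {m : A ~> C} {n : B ~> D} {f : C ~> D} :
  closed_under_MN_unions M N ->
  M A C m -> N A B g -> is_pushout g m n f -> kernel_splits g m f.
Proof.
move=> unions Mm Ng po.
have [K [E [j1 [j2 [e1 [e2 [q1 [q2 G]]]]]]]] := kernel_gluing_exists Mm Ng po.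
apply: (kernel_gluing_splits G).
have [d [d1 [d2 st]]] := glue_stable G.
have pbK := glue_ker G; case: (pbK) => ej _; red in ej.
have mm := preadh_mono hMN Mm.
have [stf pbf] := pushout_stable Mm Ng po.
case: (po) => e _; red in e.
have [L [k1 [k2 pbL]]] := hpb _ _ _ f f.
have [D' [D1 D2]] := pullback_lift pbL (erefl (f ∘ idm C)).
have [MD ND] : M _ _ D' /\ N _ _ D' by apply: hsplit; exists k1.
have [|r [r1 r2]] := pullback_lift pbL (x := m ∘ j1) (y := m ∘ j2).
  by rewrite !comp_assoc -e -!comp_assoc ej.
have [phi [p1 p2]] := pullback_lift pbL (glue_comm G).
have phi1 : phi ∘ e1 = r.
  apply: (pullback_uniq pbL); rewrite comp_assoc.
    by rewrite p1 r1 (glue_q1e1 G).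
  by rewrite p2 r2 (glue_q2e1 G).
have phi2 : phi ∘ e2 = D'.
  apply: (pullback_uniq pbL); rewrite comp_assoc.
    by rewrite p1 D1 (glue_q1e2 G).
  by rewrite p2 D2 (glue_q2e2 G).
(* [r] is the pullback of [m] along [k1]: if the first component of a pair in [L] lies in [A], so
   does the second, because the pushout square is a pullback. *)
have Mr : M _ _ r.
{ apply: (preadh_pullM hMN (f := j1) (n := m) (g := k1)) => //.
  case: (pbL) => eL _; red in eL.
  apply: pullback_intro; first by rewrite r1.
  - move=> T x y exy.
    have [|z [z1 z2]] := pullback_lift pbf (x := g ∘ x) (y := k2 ∘ y).
      by rewrite (precomp (esym eL)) -comp_assoc -exy !comp_assoc e.
    have [k [kj1 kj2]] := pullback_lift pbK (esym z1).
    exists k; split=> //; apply: (pullback_uniq pbL).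
      by rewrite (precomp r1) -comp_assoc kj1.
    by rewrite (precomp r2) -comp_assoc kj2.
  - move=> T k k' h1 h2; apply: (pullback_uniq pbK) => //; apply: mm.
    by rewrite !comp_assoc -r2 -!comp_assoc h2. }
(* Inside [L], [K] meets the diagonal of [C] in the diagonal of [A], as [m] is mono. *)
have pbA : is_pullback d m r D'.
{ apply: pullback_intro.
  - by case: st => [[ed _] _]; rewrite -phi1 -phi2 -!comp_assoc ed.
  - move=> T x y exy.
    have h1 : m ∘ (j1 ∘ x) = y.
      by rewrite comp_assoc -r1 -comp_assoc exy comp_assoc D1 comp_idl.
    have h2 : m ∘ (j2 ∘ x) = y.
      by rewrite comp_assoc -r2 -comp_assoc exy comp_assoc D2 comp_idl.
    exists (j1 ∘ x); split=> //; apply: (pullback_uniq pbK).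
      by rewrite (precomp d1) comp_idl.
    by rewrite (precomp d2) comp_idl; apply: mm; rewrite h1 h2.
  - by move=> T k k' _ /mm. }
have rm := preadh_mono hMN Mr.
have Dm := preadh_mono hMN MD.
have [phim joinphi] := union_pushout hpb rm Dm pbA st phi1 phi2.
have Mphi : M _ _ phi.
  by apply: unions; split=> //; exists K, C, r, D'.
have Nq2 : N _ _ q2.
  apply: (preadh_pushN hMN (pushout_sym (glue_pushout G))).
  exact: (preadh_pullN hMN pbK).
(* The projection [k2] of the true kernel pair is a pushout of [j2] as well, so
   [phi] is pushed out along [q2] to an identity. *)
have poL : is_pushout j2 r m k2.
  apply: (stable_pushout_pullback stf (pullback_sym pbf) (pullback_sym pbL)
    (pullback_sym pbK)) => //.
have poR : is_pushout phi q2 k2 (idm C).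
  apply: (pushout_cancel (pushout_sym (glue_pushout G))).
    by rewrite phi1 comp_idl; apply: pushout_sym.
  by rewrite comp_idl.
have [_ pbR] := pushout_stable Mphi Nq2 (pushout_sym poR).
have [|h [_ phih]] := pullback_lift pbR (x := k2) (y := idm L).
  by rewrite comp_idl comp_idr.
apply: pullback_intro; first by rewrite (glue_comm G).
- move=> T x y /esym exy; have [l [l1 l2]] := pullback_lift pbL exy.
  exists (h ∘ l); rewrite -p1 -p2 -!comp_assoc !(comp_assoc phi) phih.
  by rewrite comp_idl.
- move=> T k k' h2 h1; apply: phim; apply: (pullback_uniq pbL).
    by rewrite !comp_assoc p1.
  by rewrite !comp_assoc p2.
Qed.

(** * The Van Kampen property from the kernel pairs *)

Hypothesis kernels_split : forall {A B C D : X}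
  {g : A ~> B} {m : A ~> C} {n : B ~> D} {f : C ~> D},
  M A C m -> N A B g -> is_pushout g m n f -> kernel_splits g m f.

(** One half is stability. For the other, the top square is itself an [M],[N]-pushout, so both front
    faces can be checked on its cover of [D']. *)
Lemma pushout_van_kampen {A B C D : X}
    {g : A ~> B} {m : A ~> C} {n : B ~> D} {f : C ~> D} :
  M A C m -> N A B g -> is_pushout g m n f -> is_van_kampen g m n f.
Proof.
move=> Mm Ng po; split=> // A' B' C' D' g' m' n' f' a b c d cube pbg pbm'.
have [st pb] := pushout_stable Mm Ng po.
split; last exact: (proj2 st _ _ _ _ _ _ _ _ _ _ _ _ cube pbg pbm').
move=> po'.
have pbm := pullback_sym pbm'.
have Mm' : M _ _ m' := preadh_pullM hMN pbm Mm.
have Ng' : N _ _ g' := preadh_pullN hMN (pullback_sym pbg) Ng.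
have [st' pb'] := pushout_stable Mm' Ng' po'.
case: cube => e [e' [eg [em [en ef]]]]; red in e, e', eg, em, en, ef.
have mm := preadh_mono hMN Mm.
have nm := preadh_mono hMN (preadh_pushM hMN po Mm).
have nm' := preadh_mono hMN (preadh_pushM hMN po' Mm').
split.
- apply: pullback_intro => //; last by move=> T k k' /nm'.
  move=> T x y exy.
  have [k kx] : factors n' x.
    apply: (proj2 (stable_pushout_covers hpb x st')) => // S s [//|[z zP]].
    have [|v [v1 v2]] := pullback_lift pb (x := y ∘ s) (y := c ∘ z).
      by rewrite (precomp (esym exy)) (precomp (esym ef)) -!comp_assoc zP.
    have [w [w1 w2]] := pullback_lift pbm' (esym v2).
    by exists (g' ∘ w); rewrite (precomp e') -comp_assoc w1.
  exists k; split=> //; apply: nm.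
  by rewrite (precomp (esym en)) -comp_assoc kx.
- have [C1 [f1 [c1 pbC]]] := hpb _ _ _ d f.
  have [u [u1 u2]] := pullback_lift pbC ef.
  (* Splitting the kernel pair of [f'] leaves [v], [w] in [A'] with equal images in [B'] and in [A],
     hence equal. *)
  have um : is_mono u.
    move=> T x y exy.
    have ex : f' ∘ x = f' ∘ y by rewrite -u1 -!comp_assoc exy.
    apply: (proj1 (kernels_split Mm' Ng' po' _ _ _ ex)).
    move=> S s [//|[v [w [v1 [w1 vw]]]]].
    rewrite -v1 -w1; congr (_ ∘ _); apply: (pullback_uniq pbg) => //.
    apply: mm; rewrite !(precomp (esym em)) -!comp_assoc v1 w1.
    by rewrite -u2 -!comp_assoc !(comp_assoc u) exy.
  apply: pullback_intro => //.
    move=> T x y exy.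
    have [t [t1 t2]] := pullback_lift pbC exy.
    have lift S (s : S ~> T) (z : S ~> C') :
        f' ∘ z = x ∘ s -> c ∘ z = y ∘ s -> factors u (t ∘ s).
      move=> zx zy; exists z; apply: (pullback_uniq pbC).
        by rewrite !comp_assoc u1 t1.
      by rewrite !comp_assoc u2 t2.
    (* On the piece from [B'], the element is lifted to [A']. On the piece from [C'], [c ∘ z] and
       [y ∘ s] agree only after [f], so the kernel pair of [f] is split. *)
    have [k kt] : factors u t.
      apply: (proj2 (stable_pushout_covers hpb x st')) => // S s [[z zP]|[z zP]].
        have [|v [v1 v2]] := pullback_lift pb (x := b ∘ z) (y := y ∘ s).
          by rewrite (precomp (esym en)) (precomp (esym exy)) -!comp_assoc zP.
        have [w [w1 w2]] := pullback_lift pbg (esym v1).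
        apply: (lift _ _ (m' ∘ w)).
          by rewrite (precomp (esym e')) -comp_assoc w1.
        by rewrite (precomp em) -comp_assoc w2.
      have ez : f ∘ (c ∘ z) = f ∘ (y ∘ s).
        by rewrite (precomp (esym ef)) (precomp (esym exy)) -!comp_assoc zP.
      apply: (proj2 (kernels_split Mm Ng po _ _ _ ez)) => // S' s' cov.
      rewrite -comp_assoc; case: cov => [ezs|[v [w [v1 [w1 vw]]]]].
        apply: (lift _ _ (z ∘ s')); first by rewrite !comp_assoc zP.
        by rewrite !comp_assoc.
      (* [z] is corrected to [m' ∘ w'], where [w'] lies over [w] and has the same image under [g']
         as the lift [v'] of [v]. *)
      have [|v' [v1' v2']] := pullback_lift pbm' (x := z ∘ s') (y := v).
        by rewrite v1 comp_assoc.
      have [|w' [w1' w2']] := pullback_lift pbg (x := g' ∘ v') (y := w).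
        by rewrite (precomp eg) -comp_assoc v2'.
      apply: (lift _ _ (m' ∘ w')).
        rewrite (precomp (esym e')) -comp_assoc w1' (precomp e') -comp_assoc.
        by rewrite v1' !comp_assoc zP.
      by rewrite (precomp em) -comp_assoc w2' w1 comp_assoc.
    by exists k; rewrite -u1 -u2 -!comp_assoc kt.
  move=> T k k' ef' ec; apply: um; apply: (pullback_uniq pbC).
    by rewrite !comp_assoc u1.
  by rewrite !comp_assoc u2.
Qed.

(** * Closure under unions from the kernel pairs *)

Lemma M_of_same_subobject {U W Z : X} {u : U ~> Z} {w : W ~> Z} :
  is_mono u -> M W Z w -> sub_le u w -> sub_le w u -> M U Z u.
Proof.
move=> um Mw [k ku] [l lw].
have wm := preadh_mono hMN Mw.
rewrite -ku; apply: (preadh_compM hMN) => //; apply: (preadh_isoM hMN).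
exists l; split.
  by apply: um; rewrite (precomp lw) ku comp_idr.
by apply: wm; rewrite (precomp ku) lw comp_idr.
Qed.

Hypothesis codiagonal_N : forall (Q B : X) (v : Q ~> B),
  is_MN_codiagonal M N v -> N Q B v.

(** [h ∘ y1] and [h ∘ y2] are sections of [rho], hence in [M]. Their equalizer [w], a pullback of
    one of them, is in [M] and is the same subobject as [u]. *)
Lemma closed_under_unions : closed_under_MN_unions M N.
Proof.
move=> U Z u [um [A [B [m [n [Mm [Mn [Nn [mu [nu join]]]]]]]]]].
have mm := preadh_mono hMN Mm; have nm := preadh_mono hMN Mn.
have [P [p [q pbP]]] := hpb _ _ _ m n.
have Mp := preadh_pullM hMN (pullback_sym pbP) Mn.
have Np := preadh_pullN hMN (pullback_sym pbP) Nn.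
have Mq := preadh_pullM hMN pbP Mm.
have [U0 [i [j poU]]] := pushout_exists Mq Np.
have [stU _] := pushout_stable Mq Np poU.
case: (pbP) => eP _; red in eP.
have [u0 [u0i u0j]] := pushout_desc poU eP.
have [u0m [_ [_ join0]]] := union_pushout hpb mm nm pbP stU u0i u0j.
have [Q [y1 [y2 poQ]]] := pushout_exists Mn Nn.
have [stQ pbQ] := pushout_stable Mn Nn poQ.
case: (poQ) => eQ _; red in eQ.
have [v [vy1 vy2]] := pushout_desc poQ (erefl (idm Z ∘ n)).
have [A' [m' [v' pbA]]] := hpb _ _ _ v m.
case: (pbA) => eA _; red in eA.
have Mm' : M _ _ m' := preadh_pullM hMN (pullback_sym pbA) Mm.
(* Pulling a section of [v] back along [m'] gives a section of [v']. *)
have inj y : v ∘ y = idm Z -> exists a : A ~> A',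
    m' ∘ a = y ∘ m /\ v' ∘ a = idm A /\ is_pullback a m m' y.
  move=> vy.
  have [|a [a1 a2]] := pullback_lift pbA (x := y ∘ m) (y := idm A).
    by rewrite (precomp vy) comp_idl comp_idr.
  exists a; split=> //; split=> //; apply: pullback_intro => //.
    move=> T x z exz.
    have mz : m ∘ (v' ∘ x) = z.
      by rewrite (precomp (esym eA)) -comp_assoc exz (precomp vy) comp_idl.
    exists (v' ∘ x); split=> //; apply: (pullback_uniq pbA).
      by rewrite (precomp a1) -comp_assoc mz.
    by rewrite (precomp a2) comp_idl.
  by move=> T k k' _ /mm.
have [a1 [m'a1 [v'a1 pba1]]] := inj _ vy1.
have [a2 [m'a2 [v'a2 pba2]]] := inj _ vy2.
(* By stability of the pushout [Q], [A'] is the pushout of [p] along itself and [v'] is its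
   codiagonal. *)
have Nv' : N _ _ v'.
  apply: codiagonal_N; exists P, p; split=> //; split=> //.
  exists a1, a2; split=> //.
  apply: (stable_pushout_pullback stQ pba1 pba2 pbP) => //.
  apply: (pullback_uniq pbA).
    by rewrite (precomp m'a1) (precomp m'a2) -!comp_assoc eP !comp_assoc eQ.
  by rewrite (precomp v'a1) (precomp v'a2).
have [D [r [h poD]]] := pushout_exists Mm' Nv'.
case: (poD) => eD _; red in eD.
have [rho [rr rh]] := pushout_desc poD (esym eA).
have rhoy y : v ∘ y = idm Z -> rho ∘ (h ∘ y) = idm Z.
  by move=> vy; rewrite (precomp rh).
have [W [w' [w pbW]]] := hpb _ _ _ (h ∘ y1) (h ∘ y2).
case: (pbW) => eW _; red in eW.
(* [rho] retracts both maps, so the legs coincide and the pullback is an equalizer. *)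
have ew : w' = w.
  by rewrite -(comp_idl w') -(comp_idl w) -{1}(rhoy _ vy1) -(rhoy _ vy2)
    -!(comp_assoc rho) eW.
subst w'.
have Mw : M _ _ w.
  apply: (preadh_pullM hMN pbW).
  by case: (@hsplit _ _ (h ∘ y1)) => //; exists rho; apply: rhoy.
have wm := preadh_mono hMN Mw.
apply: (M_of_same_subobject um Mw).
- apply: join => //.
    have [|k [k1 _]] := pullback_lift pbW (x := m) (y := m); last by exists k.
    rewrite -!comp_assoc -m'a1 -m'a2 !(precomp (esym eD)) -!comp_assoc.
    by rewrite v'a1 v'a2.
  have [|k [k1 _]] := pullback_lift pbW (x := n) (y := n); last by exists k.
  by rewrite -!comp_assoc eQ.
- have [k0 k0u] : factors u0 w.
    move: eW; rewrite -!comp_assoc => eW.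
    (* Where [y1] and [y2] agree on [w], it lies in [B]; where [y1 ∘ w] lies in [A'], applying [v]
       puts [w] in [A]. *)
    apply: (proj2 (kernels_split Mm' Nv' poD _ _ _ eW)) => // S s.
    rewrite -!comp_assoc => -[ews|[x [_ [ex _]]]].
      have [k [k1 _]] := pullback_lift pbQ ews.
      by exists (j ∘ k); rewrite (precomp u0j).
    exists (i ∘ (v' ∘ x)); rewrite (precomp u0i) (precomp (esym eA)).
    by rewrite -comp_assoc ex (precomp vy1) comp_idl.
  have [l lu] := join0 _ _ um mu nu.
  by exists (l ∘ k0); rewrite (precomp lu).
Qed.

End Kernels.

(** * The two implications, each by its own source of the kernel pair description *)

Theorem corollary5p7 (X : category) (M N : arrow_class X)
    (hMN : preadhesive M N)
    (hpb : has_pullbacks X)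
    (hsplit : forall (A B : X) (f : A ~> B),
        is_split_mono f -> M A B f /\ N A B f)
    (hcodiag : forall (Q B : X) (v : Q ~> B),
        is_MN_codiagonal M N v -> N Q B v) :
  ((forall (A B : X) (m : A ~> B), M A B m -> adhesive_arrow N m) /\
   closed_under_MN_unions M N)
  <-> adhesive M N.
Proof.
split=> [[adh unions]|adh].
- have pre A C (m : A ~> C) : M A C m -> preadhesive_arrow N m.
    by move=> Mm; exact: (adh _ _ m Mm _ _ _ _ _ (pullback_sym (pullback_id m))).
  have ex A B C (m : A ~> C) (n : A ~> B) : M A C m -> N A B n ->
      exists (D : X) (p : B ~> D) (q : C ~> D), is_pushout n m p q.
    move=> Mm Nn; have [D [p [q [[po _] _]]]] := pre _ _ _ Mm _ _ Nn.
    by exists D, p, q.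
  have st A B C D (n : A ~> B) (m : A ~> C) (p : B ~> D) (q : C ~> D) :
      M A C m -> N A B n -> is_pushout n m p q ->
      is_stable_pushout n m p q /\ is_pullback n m p q.
    move=> Mm Nn po; have [E [p' [q' [st pb]]]] := pre _ _ _ Mm _ _ Nn.
    exact: (stable_pushout_transport st pb po).
  split=> //.
  move=> A B C D n m p q Mm Nn po.
  apply: (pushout_van_kampen hMN hpb st) => //.
  move=> A' B' C' D' g m' n' f Mm' Ng po'.
  exact: (kernel_splits_unions hMN hpb hsplit ex st unions Mm' Ng po').
- have vk A B C D (n : A ~> B) (m : A ~> C) (p : B ~> D) (q : C ~> D)
    (Mm : M A C m) (Nn : N A B n) :=
    @adh_van_kampen _ _ _ adh A B C D n m p q Mm Nn.
  have ex A B C (m : A ~> C) (n : A ~> B) (Mm : M A C m) (Nn : N A B n) :=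
    @adh_pushout _ _ _ adh A B C m n Mm Nn.
  have st A B C D (n : A ~> B) (m : A ~> C) (p : B ~> D) (q : C ~> D) :
      M A C m -> N A B n -> is_pushout n m p q ->
      is_stable_pushout n m p q /\ is_pullback n m p q.
    move=> Mm Nn /(vk _ _ _ _ _ _ _ _ Mm Nn) sq.
    split; first exact: van_kampen_stable.
    exact: (van_kampen_pullback (preadh_mono hMN Mm)).
  split.
    (* [M] is stable under pullback, so preadhesivity of the arrows in [M] already gives
       adhesivity. *)
    move=> B D m Mm A C f m' g pb E n Nn.
    have Mm' := preadh_pullM hMN pb Mm.
    have [F [p [q po]]] := ex _ _ _ _ _ Mm' Nn.
    by exists F, p, q; apply: st.
  apply: (closed_under_unions hMN hpb hsplit ex st) => //.
  move=> A B C D g m n f Mm Ng po.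
  apply: (kernel_splits_van_kampen hMN hpb hsplit ex st Mm Ng).
  exact: (vk _ _ _ _ _ _ _ _ Mm Ng po).
Qed.
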